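(* Let $\{\lambda_k\}_{k=1}^\infty\subset\mathbb{D}$ and assume that $\{|\lambda_k|\}_{k=1}^\infty$ is a strictly increasing sequence which satisfies the Carleson condition. Let $\{e_k\}_{k=1}^\infty$ be an orthonormal basis for a separable Hilbert space $\mathcal{H}$, let $T:\mathcal{H}\to\mathcal{H}$ be the bounded linear operator given by $Te_k:=\lambda_k e_k$, $k\in\mathbb{N}$, and let $\{m_k\}_{k=1}^\infty$ be any scalar sequence for which there are constants $C_1,C_2$ with $0<C_1\le |m_k|\le C_2<\infty$ for all $k\in\mathbb{N}$. Let $$\varphi:=\sum_{k=1}^\infty m_k\sqrt{1-|\lambda_k|^2}\,e_k.$$ Then the following hold: (i) The family $\{T^{Nk}\varphi\}_{k=0}^\infty$ is a frame for $\mathcal{H}$ for any $N\in\mathbb{N}$. (ii) If $\lambda_1\neq 0$, the family $\{T^{Nk}\varphi\}_{k=K}^\infty$ is a frame for $\mathcal{H}$ for any $N,K\in\mathbb{N}$. (iii) If $\lambda_1\neq 0$, the family $\{T^{j+Nk}\varphi\}_{k=0}^\infty$ is a frame for $\mathcal{H}$ for any $N\in\mathbb{N}$ and any $j\in\{0,1,\dots,N-1\}$.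
   Context: $\mathbb{D}$ is the open unit disc in $\mathbb{C}$ and $\mathbb{N}=\{1,2,3,\dots\}$. Hilbert spaces and scalars are complex. A sequence $\{\mu_k\}_{k=1}^\infty\subset\mathbb{D}$ satisfies the Carleson condition if $$\inf_{n\in\mathbb{N}}\ \prod_{k\neq n}\frac{|\mu_k-\mu_n|}{|1-\overline{\mu_k}\,\mu_n|}>0.$$ (The Carleson condition implies $\sum_k(1-|\mu_k|^2)<\infty$, so the series defining $\varphi$ converges in $\mathcal{H}$.) A countable family $\{f_k\}_{k\in I}$ in $\mathcal{H}$ is a frame for $\mathcal{H}$ if there are constants $A,B>0$ with $A\|f\|^2\le\sum_{k\in I}|\langle f,f_k\rangle|^2\le B\|f\|^2$ for all $f\in\mathcal{H}$. *)

(* Defs.v *)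
From HB Require Import structures.
From mathcomp Require Export all_boot all_order all_algebra sesquilinear.
From mathcomp Require Export complex.
From mathcomp Require Export all_classical all_reals all_analysis.
Set Implicit Arguments.
Unset Strict Implicit.
Unset Printing Implicit Defensive.
Import Order.TTheory GRing.Theory Num.Theory.
Import Normc.
Import numFieldNormedType.Exports.

Local Open Scope classical_set_scope.
Local Open Scope ring_scope.
Local Open Scope complex_scope.

(* On R[i] and on modules over R[i] the library norm `|x| lies in R[i];
   normc and hnorm are its real-valued forms. *)

Definition hnorm (R : realType) (H : normedModType R[i]) (x : H) : R :=
  complex.Re `|x|.

(* A Hilbert space is a complete normed module over R[i] with a positive
   definite Hermitian form (linear in its first argument) that satisfies this
   compatibility with the norm. *)
Definition induces_norm (R : realType) (H : normedModType R[i])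
    (ip : {dot H for Num.conj}) : Prop :=
  forall x : H, `|x| ^+ 2 = ip x x.

Definition orthonormal_basis (R : realType) (H : normedModType R[i])
    (ip : {dot H for Num.conj}) (e : nat -> H) : Prop :=
  (forall j k, ip (e j) (e k) = (j == k)%:R) /\
  (forall f : H, series (fun k => ip f (e k) *: e k) @ \oo --> f).

(* For mu in the open unit disc every factor lies in [0, 1], so the partial
   products do converge and the infimum is over a set bounded below by 0. *)
Definition carleson (R : realType) (mu : nat -> R[i]) : Prop :=
  0 < inf (range (fun n : nat =>
    limn (fun M : nat => \prod_(0 <= k < M | k != n)
      (normc (mu k - mu n) / normc (1 - (mu k)^* * mu n))))).

(* The sum is over nonnegative terms in \bar R, so no summability is
   presupposed; the upper bound enforces it. *)
Definition frame (R : realType) (H : normedModType R[i])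
    (ip : {dot H for Num.conj}) (J : countType) (I : set J) (g : J -> H)
    : Prop :=
  exists A B : R, [/\ 0 < A, 0 < B & forall f : H,
    ((A * hnorm f ^+ 2)%:E <= \esum_(k in I) (normc (ip f (g k)) ^+ 2)%:E)%E /\
    (\esum_(k in I) (normc (ip f (g k)) ^+ 2)%:E <= (B * hnorm f ^+ 2)%:E)%E].

(* Main.v *)
Require Import Defs.
From mathcomp Require Import ring lra.
Set Implicit Arguments.
Unset Strict Implicit.
Unset Printing Implicit Defensive.
Import Order.TTheory GRing.Theory Num.Theory.
Import Normc.
Import numFieldNormedType.Exports.

Local Open Scope classical_set_scope.
Local Open Scope ring_scope.
Local Open Scope complex_scope.

(** Write [a k] for the coordinates of [f] and [x k] for the conjugate of
    [lambda k ^+ N]. The inner products of [f] with the orbit are the sums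
    [\sum_k a k * w k * x k ^+ n], where the weight [w k] has modulus comparable
    to [eta k], the square root of [1 - normc (x k)]. The frame property says
    that the sum over [n] of the squared moduli is comparable to
    [\sum_k normc (a k) ^+ 2], that is, that the normalized Szego kernels at the
    points [lambda k ^+ N] form a Riesz sequence. All three parts are this statement, for
    different weights ([orbit_frame]).

    The Carleson condition keeps the radii [normc (lambda k)] uniformly separated
    in the pseudohyperbolic metric ([carleson_separated]). Since they increase,
    the numbers [1 - normc (lambda k)] decrease geometrically, and then so do the
    numbers [1 - normc (x k)], for every [N] ([pow_radii_geometric]).

    The Gram matrix of the kernels, whose entry at [(j, k)] is
    [w j * conj (w k)] divided by [1 - x j * conj (x k)], then decays
    geometrically away from its diagonal ([gram_decay]), so that [schur_test]
    gives the upper bound. For the lower bound, the Gram matrix is a Cauchy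
    matrix with an explicit inverse ([cauchy_invP], obtained from Lagrange
    interpolation). The entries of the inverse are those of the Gram matrix of
    the normalized kernels, up to unimodular constants, bounded factors and
    reciprocals of Blaschke products; the latter are bounded because the nodes
    approach the circle geometrically ([prod_ratio_le]). So the inverse decays
    geometrically too and is bounded by the same Schur test, which bounds the
    form of the Gram matrix from below ([form_lower_bound]).

    All estimates concern finitely many nodes, with constants independent of
    their number, and pass to the limit by [frame_of_finite]. *)

(** * Inversion of Cauchy matrices *)

Section CauchyInverse.
Variable F : fieldType.

(** The homogenization of [p] in degree [d], evaluated at [(1, z)]: it equals
    [z ^+ d * p.[z^-1]] when [z] is nonzero, and still makes sense at [z = 0],
    which matters because one of the nodes below may vanish. *)
Definition rev_horner (d : nat) (p : {poly F}) (z : F) : F :=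
  \sum_(k < d.+1) p`_k * z ^+ (d - k).

Lemma size_prod_affine (I : Type) (r : seq I) (a b : I -> F) :
  (size (\prod_(j <- r) ((a j)%:P + b j *: 'X))%R <= (size r).+1)%N.
Proof.
elim: r => [|i r IH]; first by rewrite big_nil size_poly1.
rewrite big_cons (leq_trans (size_polyMleq _ _)) //=.
have : (size ((a i)%:P + b i *: 'X)%R <= 2)%N.
  rewrite (leq_trans (size_polyD _ _)) // geq_max (leq_trans (size_polyC_leq1 _)) //.
  by rewrite (leq_trans (size_scale_leq _ _)) // size_polyX.
by move=> sz2; rewrite -subn1 leq_subLR; exact: leq_add sz2 IH.
Qed.

Lemma rev_horner_prod (I : Type) (r : seq I) (a b : I -> F) (z : F) :
  rev_horner (size r) (\prod_(j <- r) ((a j)%:P + b j *: 'X)) z =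
  \prod_(j <- r) (a j * z + b j).
Proof.
elim: r => [|i r IH].
  rewrite !big_nil.
  by rewrite /rev_horner big_ord_recl big_ord0 subn0 coef1 /= expr0 addr0 mulr1.
rewrite !big_cons -IH /=; have := size_prod_affine r a b.
set p := \prod_(j <- r) _ => szr.
rewrite mulrDl mul_polyC -scalerAl [in 'X * p]mulrC.
rewrite /rev_horner.
under eq_bigr => k _ do rewrite coefD !coefZ coefMX mulrDl.
rewrite big_split /= mulrDl; congr (_ + _).
  rewrite big_ord_recr /= (nth_default _ szr) mulr0 mul0r addr0 -mulrA !mulr_sumr.
  apply: eq_bigr => k _; rewrite -!mulrA; congr (_ * _).
  by rewrite subSn ?exprS 1?mulrCA // -ltnS.
rewrite big_ord_recl /= mulr0 mul0r add0r mulr_sumr.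
by apply: eq_bigr => k _; rewrite -mulrA.
Qed.

Lemma lagrange_interp n (y : 'I_n -> F) (P : {poly F}) : injective y ->
  (size P <= n)%N ->
  P = \sum_m (P.[y m] / \prod_(j | j != m) (y m - y j)) *:
        \prod_(j | j != m) ('X - (y j)%:P).
Proof.
move=> yi szP; apply/eqP; rewrite -subr_eq0; apply/eqP.
set L := \sum_m _.
have szL : (size L <= n)%N.
  apply: (leq_trans (size_sum _ _ _)); apply/bigmax_leqP => m _.
  rewrite (leq_trans (size_scale_leq _ _)) // -big_enum /= size_prod_XsubC.
  by rewrite -cardE cardC1 card_ord prednK // (leq_ltn_trans _ (ltn_ord m)).
apply: (@roots_geq_poly_eq0 _ _ (codom y)).
- apply/allP => _ /codomP [i ->]; rewrite /root hornerD hornerN horner_sum.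
  rewrite (bigD1 i) //= [X in _ - (_ + X)]big1 ?addr0 => [|m mi].
    rewrite hornerZ horner_prod.
    have -> : \prod_(j < n | j != i) ('X - (y j)%:P).[y i] =
        \prod_(j < n | j != i) (y i - y j).
      by apply: eq_bigr => j _; rewrite hornerXsubC.
    rewrite divfK ?subrr // prodf_seq_neq0; apply/allP => j _ /=.
    apply/implyP => ji; rewrite subr_eq0 (inj_eq yi) eq_sym //.
  rewrite hornerZ horner_prod [X in _ * X](bigD1 i) 1?eq_sym //= hornerXsubC subrr.
  by rewrite mul0r mulr0.
- by rewrite map_inj_uniq ?enum_uniq.
- rewrite size_codom card_ord (leq_trans (size_polyD _ _)) // size_polyN.
  by rewrite geq_max szP.
Qed.

(** Interpolate the polynomial [\prod_(j != k) (1 - x j * 'X)] at the nodes [y]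
    and apply [rev_horner], which turns every factor [a + b 'X] into
    [a z + b]. *)
Lemma sum_lagrange_rev n (x y : 'I_n -> F) (k : 'I_n) (z : F) : injective y ->
  \sum_m (\prod_(j | j != k) (1 - x j * y m) / \prod_(j | j != m) (y m - y j))
      * \prod_(j | j != m) (1 - z * y j)
  = \prod_(j | j != k) (z - x j).
Proof.
move=> yi.
have szE (m : 'I_n) : size (enum (predC1 m)) = n.-1.
  by rewrite -cardE cardC1 card_ord.
have nE (m : 'I_n) : n.-1.+1 = n by rewrite prednK // (leq_ltn_trans _ (ltn_ord m)).
pose P := \prod_(j <- enum (predC1 k)) (1%:P + (- x j) *: 'X) : {poly F}.
have PE t : P.[t] = \prod_(j | j != k) (1 - x j * t).
  rewrite /P big_enum /= horner_prod; apply: eq_bigr => j _.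
  by rewrite hornerD hornerC hornerZ hornerX mulNr.
have szP : (size P <= n)%N.
  by rewrite /P (leq_trans (size_prod_affine _ _ _)) // szE nE.
have -> : \prod_(j | j != k) (z - x j) = rev_horner n.-1 P z.
  rewrite /P -(szE k) rev_horner_prod big_enum /=.
  by apply: eq_bigr => j _; rewrite mul1r.
rewrite (lagrange_interp yi szP) /rev_horner.
under [RHS]eq_bigr => i _ do rewrite coef_sum mulr_suml.
rewrite exchange_big /=; apply: eq_bigr => m _.
under [RHS]eq_bigr => i _ do rewrite coefZ -mulrA.
rewrite -mulr_sumr PE; congr (_ * _).
have := @rev_horner_prod _ (enum (predC1 m)) (fun j => - y j) (fun=> 1) z.
rewrite szE /rev_horner !big_enum /= => E.
under [LHS]eq_bigr => j _ do rewrite addrC -[z * _]mulrC -mulNr.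
rewrite -E; apply: eq_bigr => i _; congr ((polyseq _)`_ _ * _).
by apply: eq_bigr => j _; rewrite scale1r polyCN addrC.
Qed.

(** When [y] is the conjugate of [x], the entry at [(m, k)] is the coefficient of
    the Szego kernel at [x m] in the combination of kernels that takes the value
    1 at [x k] and 0 at the other nodes. *)
Definition cauchy_inv n (x y : 'I_n -> F) (m k : 'I_n) : F :=
  \prod_j (1 - x k * y j) / \prod_(j | j != k) (x k - x j)
  * (\prod_(j | j != k) (1 - x j * y m) / \prod_(j | j != m) (y m - y j)).

(** The sum of [sum_lagrange_rev] at [z = x i], divided by
    [\prod_j (1 - x i * y j)]; for [i != k] its right-hand side has the zero
    factor [x i - x i]. *)
Lemma cauchy_invP n (x y : 'I_n -> F) (i k : 'I_n) :
  injective x -> injective y -> (forall j m, 1 - x j * y m != 0) ->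
  \sum_m (1 - x i * y m)^-1 * cauchy_inv x y m k = (i == k)%:R.
Proof.
move=> xi yi xy.
have nz : \prod_j (1 - x i * y j) != 0.
  by rewrite prodf_seq_neq0; apply/allP => j _; rewrite xy.
have -> : \sum_m (1 - x i * y m)^-1 * cauchy_inv x y m k =
   \prod_j (1 - x k * y j) / \prod_(j | j != k) (x k - x j) *
   (\prod_(j | j != k) (x i - x j) / \prod_j (1 - x i * y j)).
  rewrite -(sum_lagrange_rev x k (x i) yi) mulr_suml mulr_sumr.
  apply: eq_bigr => m _; rewrite /cauchy_inv mulrCA; congr (_ * _).
  have nzm : \prod_(j | j != m) (1 - x i * y j) != 0.
    by rewrite prodf_seq_neq0; apply/allP => j _; rewrite xy implybT.
  rewrite (bigD1 m (P := predT) (F := fun j => 1 - x i * y j)) //= invfM.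
  by rewrite [RHS]mulrCA mulfK // mulrC.
case: eqVneq => [<-|ik].
  have nzi : \prod_(j | j != i) (x i - x j) != 0.
    rewrite prodf_seq_neq0; apply/allP => j _; apply/implyP => ji.
    by rewrite subr_eq0 (inj_eq xi) eq_sym.
  by rewrite mulrA divfK // divff.
by rewrite [X in _ * (X / _)](bigD1 i) //= subrr !mul0r mulr0.
Qed.

End CauchyInverse.

(** * Moduli, the Schur test and positive forms *)

Section ComplexModulus.
Variable R : realType.
Implicit Types z u : R[i].

Lemma normc_ge0 z : 0 <= normc z.
Proof. by case: z => a b; exact: sqrtr_ge0. Qed.

Lemma sqr_normcE z : (normc z ^+ 2)%:C = z * z^*.
Proof. by rewrite rmorphXn /= -sqr_normc. Qed.

Lemma normc_conj z : normc z^* = normc z.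
Proof. by case: z => a b /=; rewrite sqrrN. Qed.

Lemma normc_real (r : R) : normc r%:C = `|r|.
Proof. by rewrite /= expr0n addr0 sqrtr_sqr. Qed.

Lemma normcX z n : normc (z ^+ n) = normc z ^+ n.
Proof. by elim: n => [|n IH]; rewrite ?normc1 // !exprS normcM IH. Qed.

Lemma normc_eq0 z : (normc z == 0) = (z == 0).
Proof. by apply/eqP/eqP => [/eq0_normc //|->]; rewrite normc0. Qed.

Lemma normcB z u : normc (z - u) = normc (u - z).
Proof. by rewrite -normcN opprB. Qed.

Lemma normc_sum (I : Type) (r : seq I) (P : pred I) (f : I -> R[i]) :
  normc (\sum_(i <- r | P i) f i) <= \sum_(i <- r | P i) normc (f i).
Proof.
elim/big_rec2: _ => [|i x z _ le_zx]; first by rewrite normc0.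
by rewrite (le_trans (le_normcD _ _)) // lerD2l.
Qed.

Lemma normc_prod (I : Type) (r : seq I) (P : pred I) (f : I -> R[i]) :
  normc (\prod_(i <- r | P i) f i) = \prod_(i <- r | P i) normc (f i).
Proof. exact: (big_morph _ (@normcM _) (@normc1 _)). Qed.

Lemma Re_le_normc z : `|complex.Re z| <= normc z.
Proof.
case: z => a b /=; rewrite -sqrtr_sqr ler_wsqrtr // lerDl sqr_ge0 //.
Qed.

Lemma sum_sqr_normcE (I : finType) (a : I -> R[i]) :
  (\sum_i normc (a i) ^+ 2)%:C = \sum_i a i * (a i)^*.
Proof. by rewrite rmorph_sum /=; apply: eq_bigr => i _; rewrite sqr_normcE. Qed.

Lemma subr_normc_le z u : normc z - normc u <= normc (z - u).
Proof. by rewrite lerBlDr -{1}[z](subrK u) le_normcD. Qed.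

Lemma sqr_normcD_le z u :
  normc (z + u) ^+ 2 <= 2 * normc z ^+ 2 + 2 * normc u ^+ 2.
Proof.
have := le_normcD z u; have := normc_ge0 (z + u).
set a := normc (z + u); set b := normc z; set c := normc u => a0 abc.
apply: (le_trans (y := (b + c) ^+ 2)); first by rewrite ler_sqr ?nnegrE //; lra.
by have := sqr_ge0 (b - c); rewrite !expr2; lra.
Qed.

Lemma Re_add z u : complex.Re (z + u) = complex.Re z + complex.Re u.
Proof. by case: z; case: u. Qed.

Lemma Re_opp z : complex.Re (- z) = - complex.Re z.
Proof. by case: z. Qed.

Lemma Re_scale (r : R) z : complex.Re (r%:C * z) = r * complex.Re z.
Proof. by case: z => a b /=; rewrite mul0r subr0. Qed.

End ComplexModulus.

Section Schur.
Variable R : realType.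

Definition dist (j k : nat) : nat := (j - k + (k - j))%N.

Lemma distC j k : dist j k = dist k j.
Proof. exact: addnC. Qed.

Lemma geo_dist_sum (p : R) M j : 0 <= p < 1 ->
  \sum_(k < M) p ^+ dist j k <= 2 / (1 - p).
Proof.
move=> /andP[p0 p1].
have q0 : 0 < 1 - p by lra.
rewrite ler_pdivlMr // mulrC.
(* The first induction sums up to the diagonal, the second one beyond it. *)
have lo : forall m, (m <= j)%N ->
    (1 - p) * \sum_(k < m) p ^+ dist j k <= p ^+ (j.+1 - m).
  elim=> [|m IH] mj; first by rewrite big_ord0 mulr0 exprn_ge0.
  rewrite big_ord_recr /= mulrDr.
  have := IH (ltnW mj); rewrite subSn 1?ltnW // subSS.
  rewrite /dist (eqP (ltnW mj : (m - j == 0)%N)) addn0 exprS; lra.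
have hi : forall m,
    (1 - p) * \sum_(k < j + m) p ^+ dist j k <= 1 + p - p ^+ m.
  elim=> [|m IH].
    by rewrite addn0 (le_trans (lo j _)) // subSnn expr1 expr0; lra.
  rewrite addnS big_ord_recr /= mulrDr exprS.
  rewrite /dist (eqP (leq_addr m j : (j - (j + m) == 0)%N)) addKn add0n.
  move: IH; rewrite -/(dist _ _); lra.
case: (leqP M j) => Mj.
  by have := lo _ Mj; have := exprn_ile1 (j.+1 - M) p0 (ltW p1); lra.
have := hi (M - j)%N; rewrite subnKC 1?ltnW // => /le_trans-> //.
by have := exprn_ge0 (M - j) p0; lra.
Qed.

(** Bound [normc (a j) * normc (a k)] by half the sum of the squares; every
    row sum of [p ^+ dist j k] is at most [2 / (1 - p)]. *)
Lemma schur_test (p C : R) M (g : 'I_M -> 'I_M -> R[i]) (a : 'I_M -> R[i]) :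
  0 <= p < 1 -> 0 <= C ->
  (forall j k : 'I_M, normc (g j k) <= C * p ^+ dist j k) ->
  normc (\sum_j \sum_k a j * (a k)^* * g j k)
    <= C * (2 / (1 - p)) * \sum_j normc (a j) ^+ 2.
Proof.
move=> p01 C0 gC; have /andP[p0 p1] := p01.
pose S := \sum_(j < M) \sum_(k < M) normc (a j) ^+ 2 * p ^+ dist j k.
have SE : S = \sum_(j < M) \sum_(k < M) normc (a k) ^+ 2 * p ^+ dist j k.
  by rewrite exchange_big; do 2!apply: eq_bigr => ? _; rewrite distC.
have leS : S <= 2 / (1 - p) * \sum_j normc (a j) ^+ 2.
  rewrite mulr_sumr; apply: ler_sum => j _; rewrite -mulr_sumr mulrC.
  by apply: ler_wpM2r; rewrite ?sqr_ge0 ?geo_dist_sum.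
rewrite -mulrA; apply: le_trans (ler_wpM2l C0 leS).
have -> : C * S = \sum_(j < M) \sum_(k < M)
   (normc (a j) ^+ 2 + normc (a k) ^+ 2) / 2 * (C * p ^+ dist j k).
  have {1}-> : S = (S + S) / 2 by field.
  rewrite {2}SE /S -big_split mulr_suml mulr_sumr.
  apply: eq_bigr => j _; rewrite -big_split mulr_suml mulr_sumr.
  by apply: eq_bigr => k _ /=; field.
apply: (le_trans (normc_sum _ _ _)); apply: ler_sum => j _.
apply: (le_trans (normc_sum _ _ _)); apply: ler_sum => k _.
rewrite !normcM normc_conj; apply: ler_pM; rewrite ?normc_ge0 ?mulr_ge0 ?normc_ge0 //.
have := sqr_ge0 (normc (a j) - normc (a k)); rewrite !expr2; lra.
Qed.

(** A bound on the inverse of a positive matrix bounds its form from below,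
    without any spectral theory: with [B d v] the dot product of [a] and [v]
    (so [d] is [a] times the inverse matrix), positivity at [a - t d] reads
    [0 <= B a a - 2 t |a|^2 + t^2 B d d], where [B d d <= K |a|^2]; the best
    choice is [t = K^-1]. *)
Lemma form_lower_bound M (g D : 'I_M -> 'I_M -> R[i]) (K : R) :
  0 < K ->
  (forall j k, g j k = (g k j)^*) ->
  (forall n k, \sum_j D n j * g j k = (n == k)%:R) ->
  (forall a : 'I_M -> R[i], 0 <= complex.Re (\sum_j \sum_k a j * (a k)^* * g j k)) ->
  (forall a : 'I_M -> R[i],
     normc (\sum_j \sum_k a j * (a k)^* * D j k) <= K * \sum_j normc (a j) ^+ 2) ->
  forall a : 'I_M -> R[i],
    K^-1 * \sum_j normc (a j) ^+ 2 <= complex.Re (\sum_j \sum_k a j * (a k)^* * g j k).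
Proof.
move=> K0 gH Dg gpos DK a.
pose B (u v : 'I_M -> R[i]) := \sum_j \sum_k u j * (v k)^* * g j k.
pose d j := \sum_n a n * D n j.
have Bd v : B d v = \sum_k a k * (v k)^*.
  rewrite /B exchange_big /=; apply: eq_bigr => k _.
  transitivity (\sum_n \sum_j (a n * (v k)^*) * (D n j * g j k)).
    rewrite exchange_big; apply: eq_bigr => j _; rewrite /d -mulrA mulr_suml.
    by apply: eq_bigr => n _; rewrite /=; ring.
  under eq_bigr => n _ do rewrite -mulr_sumr Dg.
  rewrite (bigD1 k) //= eqxx mulr1 big1 ?addr0 // => n /negPf ->.
  by rewrite mulr0.
have BC u v : B v u = (B u v)^*.
  rewrite /B exchange_big rmorph_sum /=; apply: eq_bigr => j _.
  rewrite rmorph_sum /=; apply: eq_bigr => k _.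
  by rewrite !rmorphM /= conjcK (gH k j); ring.
have Bdd : complex.Re (B d d) <= K * \sum_j normc (a j) ^+ 2.
  apply: le_trans (DK a); apply: le_trans (ler_norm _) _.
  apply: le_trans (Re_le_normc _) _.
  suff -> : B d d = (\sum_j \sum_k a j * (a k)^* * D j k)^* by rewrite normc_conj.
  rewrite Bd exchange_big rmorph_sum /=; apply: eq_bigr => k _.
  rewrite /d !rmorph_sum mulr_sumr; apply: eq_bigr => n _.
  by rewrite !rmorphM /= conjcK; ring.
clearbody d.
pose t : R := K^-1.
have expand : B (fun j => a j - t%:C * d j) (fun j => a j - t%:C * d j) =
   B a a - t%:C * (B d a + B a d) + (t ^+ 2)%:C * B d d.
  rewrite /B -big_split !mulr_sumr -!sumrB -big_split; apply: eq_bigr => j _.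
  rewrite -big_split !mulr_sumr -!sumrB -big_split; apply: eq_bigr => k _ /=.
  rewrite [X in _ * X * _ = _](_ : _ = (a k)^* - t%:C * (d k)^*); last first.
    by rewrite rmorphB rmorphM /=; congr (_ - _ * _); exact: conjc_real.
  rewrite rmorphXn; move: (d j) (d k) => dj dk /=; ring.
have := gpos (fun j => a j - t%:C * d j).
rewrite -/(B _ _) expand -/(B a a) [B a d]BC.
have Bda : B d a = (\sum_j normc (a j) ^+ 2)%:C by rewrite Bd sum_sqr_normcE.
rewrite Bda conjc_real.
set S : R := \sum_j _ in Bdd *; set Q := B a a.
rewrite Re_add [complex.Re (Q - _)]Re_add Re_opp !Re_scale Re_add /= => pos.
have leK : t ^+ 2 * complex.Re (B d d) <= t * S.
  have -> : t * S = t ^+ 2 * (K * S) by rewrite /t; field; lra.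
  by rewrite ler_wpM2l ?sqr_ge0.
have sub_le (q b c : R) : 0 <= q - (b + b) + c -> c <= b -> b <= q by lra.
rewrite mulrDr in pos.
exact: (sub_le (complex.Re Q) (t * S) (t ^+ 2 * complex.Re (B d d)) pos leK).
Qed.
End Schur.

(** * Sampling bounds for nodes approaching the circle geometrically *)

Lemma le_geometric_error (R : realType) (u v K r : R) : 0 <= r < 1 ->
  (forall P : nat, u <= v + K * r ^+ P) -> u <= v.
Proof.
move=> /andP[r0 r1] h.
have c : (fun P => v + K * r ^+ P) @ \oo --> v.
  rewrite -[X in _ --> X]addr0 -[X in _ + X](mulr0 K).
  apply: cvgD; first exact: cvg_cst.
  by apply: cvgM; [exact: cvg_cst|apply: cvg_expr; rewrite ger0_norm].
rewrite -(cvg_lim _ c) //; apply: limr_ge; first by apply/cvg_ex; exists v.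
by near=> n; exact: h.
Unshelve. all: by end_near.
Qed.

Section Sampling.
Variables (R : realType) (x w : nat -> R[i]) (eta : nat -> R) (p c1 c2 : R).
(* The nodes [x k] approach the unit circle geometrically: [eta k] is the square
   root of the distance of [x k] to the circle. *)
Hypothesis p01 : 0 < p < 1.
Hypothesis eta_gt0 : forall k, 0 < eta k.
Hypothesis eta_geo : forall k, eta k.+1 <= p * eta k.
Hypothesis normx : forall k, normc (x k) = 1 - eta k ^+ 2.
Hypothesis c1_gt0 : 0 < c1.
Hypothesis normw : forall k, c1 * eta k <= normc (w k) <= c2 * eta k.

Let p0 : 0 < p. Proof. by case/andP: p01. Qed.
Let p1 : p < 1. Proof. by case/andP: p01. Qed.
Let q0 : 0 < 1 - p. Proof. by rewrite subr_gt0. Qed.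
Let p01' : 0 <= p < 1. Proof. by rewrite ltW. Qed.

Lemma eta_decay j n : eta (j + n)%N <= p ^+ n * eta j.
Proof.
elim: n => [|n IH]; first by rewrite addn0 mul1r.
rewrite addnS (le_trans (eta_geo _)) // exprS -mulrA.
by rewrite ler_wpM2l // ltW.
Qed.

Lemma eta_decr j k : (j <= k)%N -> eta k <= eta j.
Proof.
move=> /subnKC <-; apply: (le_trans (eta_decay _ _)).
by rewrite ler_piMl ?(ltW (eta_gt0 _)) // exprn_ile1 ?(ltW p0) ?(ltW p1).
Qed.

Lemma normx_lt1 k : normc (x k) < 1.
Proof. by rewrite normx; have := exprn_gt0 2 (eta_gt0 k); lra. Qed.

Lemma normx_le j k : normc (x j * (x k)^*) <= normc (x j).
Proof. by rewrite normcM normc_conj ler_piMr ?normc_ge0 // ltW ?normx_lt1. Qed.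

Lemma kern_ge j k : eta j ^+ 2 <= normc (1 - x j * (x k)^*).
Proof.
have := subr_normc_le 1 (x j * (x k)^*); have := normx_le j k.
by rewrite normc1 normx; lra.
Qed.

Lemma kern_diag_le k : normc (1 - x k * (x k)^*) <= 2 * eta k ^+ 2.
Proof.
have lt1 := normx_lt1 k; have ge0 := normc_ge0 (x k).
rewrite -sqr_normcE -(rmorph1 (real_complex R)) -rmorphB normc_real ger0_norm.
  by rewrite normx; have := sqr_ge0 (eta k ^+ 2); rewrite !expr2; lra.
by rewrite subr_ge0 exprn_ile1 // ltW.
Qed.

Lemma kern_gt0 j k : 0 < normc (1 - x j * (x k)^*).
Proof. exact: lt_le_trans (exprn_gt0 2 (eta_gt0 j)) (kern_ge j k). Qed.

Lemma kern_neq0 j k : 1 - x j * (x k)^* != 0.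
Proof. by rewrite -normc_eq0 gt_eqF ?kern_gt0. Qed.

Lemma kern_sym j k : normc (1 - x j * (x k)^*) = normc (1 - x k * (x j)^*).
Proof.
rewrite -[RHS]normc_conj; congr normc.
by rewrite rmorphB rmorphM rmorph1 /= conjcK mulrC.
Qed.

(** The normalized kernels decorrelate geometrically: the denominator is at
    least [eta j ^+ 2] and at least [eta k ^+ 2], so the quotient is at most
    the ratio of the smaller to the larger of [eta j] and [eta k]. *)
Lemma kern_decay j k :
  eta j * eta k / normc (1 - x j * (x k)^*) <= p ^+ dist j k.
Proof.
wlog jk : j k / (j <= k)%N => [H|].
  case/orP: (leq_total j k) => jk; first exact: H.
  by rewrite [eta j * _]mulrC kern_sym distC; apply: H.
rewrite ler_pdivrMr ?kern_gt0 //.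
have -> : dist j k = (k - j)%N by rewrite /dist (eqP (jk : (j - k == 0)%N)).
apply: (le_trans (y := p ^+ (k - j) * eta j ^+ 2)).
  rewrite expr2 mulrCA ler_pM2l ?eta_gt0 //.
  by rewrite -{1}(subnKC jk) eta_decay.
by rewrite ler_wpM2l ?kern_ge // exprn_ge0 // ltW.
Qed.

(** The reciprocal of the pseudohyperbolic distance. *)
Let ratio j k := normc (1 - x j * (x k)^*) / normc (x j - x k).

Lemma ratio_sym j k : ratio j k = ratio k j.
Proof. by rewrite /ratio kern_sym normcB. Qed.

(** For [j < k] the point [x k] is much closer to the circle than [x j]. The
    numerator exceeds [normc (x j - x k)] by at most [2 * eta k ^+ 2], while
    [normc (x j - x k)] is at least [eta j ^+ 2 - eta k ^+ 2]; so the ratio is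
    at most [1 + 2 t / (1 - t)] with [t = p ^+ dist j k]. The exponential form
    turns the product of the ratios into a geometric sum. *)
Lemma ratio_le j k : j != k ->
  ratio j k <= expR (2 / (1 - p) * p ^+ dist j k).
Proof.
wlog jk : j k / (j < k)%N => [H|_].
  case: (ltngtP j k) => jk // _; first by apply: H => //; rewrite ltn_eqF.
  by rewrite ratio_sym distC; apply: H => //; rewrite ltn_eqF.
have -> : dist j k = (k - j)%N.
  by rewrite /dist (eqP (ltnW jk : (j - k == 0)%N)).
set t := p ^+ (k - j).
have t0 : 0 < t by rewrite exprn_gt0.
have tp : t <= p.
  by rewrite /t -(subnSK jk) exprS ler_piMr ?exprn_ile1 ?(ltW p0) ?(ltW p1).
have t1 : t < 1 := le_lt_trans tp p1.
have p1' := p1.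
have ekt : eta k ^+ 2 <= t * eta j ^+ 2.
  have h : eta k <= t * eta j by rewrite -{1}(subnKC (ltnW jk)) eta_decay.
  apply: (le_trans (y := (t * eta j) ^+ 2)).
    by rewrite ler_sqr ?nnegrE ?mulr_ge0 ?(ltW t0) ?(ltW (eta_gt0 _)).
  rewrite exprMn ler_wpM2r ?sqr_ge0 // expr2 ler_piMr ?(ltW t0) //.
  exact: ltW.
have ej0 := exprn_gt0 2 (eta_gt0 j).
have dxy : (1 - t) * eta j ^+ 2 <= normc (x j - x k).
  by have := subr_normc_le (x k) (x j); rewrite normcB !normx; lra.
have d0 : 0 < normc (x j - x k).
  by apply: lt_le_trans dxy; rewrite mulr_gt0 //; lra.
have num : normc (1 - x j * (x k)^*) <= normc (x j - x k) + 2 * eta k ^+ 2.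
  have -> : 1 - x j * (x k)^* = (x k - x j) * (x k)^* + (1 - x k * (x k)^*).
    by ring.
  apply: (le_trans (le_normcD _ _)); apply: lerD.
    by rewrite normcM normc_conj normcB ler_piMr ?normc_ge0 // ltW ?normx_lt1.
  exact: kern_diag_le.
apply: (le_trans (y := 1 + 2 / (1 - p) * t)); last exact: expR_ge1Dx.
rewrite /ratio ler_pdivrMr // mulrDl mul1r (le_trans num) // lerD2l.
apply: (le_trans (y := 2 / (1 - p) * t * ((1 - t) * eta j ^+ 2))); last first.
  by rewrite ler_wpM2l // mulr_ge0 ?(ltW t0) // divr_ge0 //; lra.
have -> : 2 / (1 - p) * t * ((1 - t) * eta j ^+ 2) =
    2 * (t * eta j ^+ 2) * ((1 - t) / (1 - p)) by field; lra.
apply: (le_trans (y := 2 * (t * eta j ^+ 2))); first by rewrite ler_wpM2l.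
rewrite ler_peMr //; first by rewrite !mulr_ge0 // ltW.
by rewrite ler_pdivlMr // mul1r lerD2l lerN2.
Qed.

(** A lower bound for all finite Blaschke products of the other nodes, uniform
    in their number. *)
Lemma prod_ratio_le M (n : 'I_M) :
  \prod_(i < M | i != n) ratio n i <= expR ((2 / (1 - p)) ^+ 2).
Proof.
apply: (le_trans (y := \prod_(i < M | i != n) expR (2 / (1 - p) * p ^+ dist n i))).
  apply: ler_prod => i ni; rewrite ratio_le 1?eq_sym // andbT.
  by rewrite divr_ge0 ?normc_ge0.
rewrite -expR_sum ler_expR -mulr_sumr expr2 ler_wpM2l //.
  by rewrite divr_ge0 // ltW.
apply: (le_trans _ (geo_dist_sum M n p01')).
rewrite [X in _ <= X](bigID (fun i => i != n)) /= lerDl.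
by apply: sumr_ge0 => i _; rewrite exprn_ge0 ?ltW.
Qed.

(* The Gram matrix of the sequences [n |-> w j * x j ^+ n]. *)
Let g (j k : nat) := w j * (w k)^* / (1 - x j * (x k)^*).

Lemma gram_decay j k : normc (g j k) <= c2 ^+ 2 * p ^+ dist j k.
Proof.
rewrite !normcM normc_conj normcV.
have /andP[_ wj] := normw j; have /andP[_ wk] := normw k.
apply: (le_trans (y := c2 ^+ 2 * (eta j * eta k / normc (1 - x j * (x k)^*)))).
  rewrite mulrA ler_wpM2r ?invr_ge0 ?normc_ge0 //.
  by rewrite expr2 mulrACA ler_pM ?normc_ge0.
by rewrite ler_wpM2l ?sqr_ge0 ?kern_decay.
Qed.

Lemma x_inj j k : x j = x k -> j = k.
Proof.
wlog jk : j k / (j < k)%N => [H|].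
  by case: (ltngtP j k) => // jk xx; [apply: H|apply/esym/H].
move=> /(congr1 (@normc R)); rewrite !normx => /eqP.
rewrite (inj_eq (addrI _)) eqr_opp => /eqP xx.
have : eta k ^+ 2 < eta j ^+ 2.
  rewrite ltr_sqr ?nnegrE ?(ltW (eta_gt0 _)) // (le_lt_trans (eta_decr jk)) //.
  by rewrite (le_lt_trans (eta_geo _)) // gtr_pMl.
by rewrite xx ltxx.
Qed.

Let gram_inv M (n j : 'I_M) : R[i] :=
  cauchy_inv (fun i : 'I_M => (x i)^*) (fun i : 'I_M => x i) j n / (w j * (w n)^*).

Lemma w_neq0 k : w k != 0.
Proof.
have /andP[h _] := normw k; rewrite -normc_eq0 gt_eqF //.
by rewrite (lt_le_trans _ h) // mulr_gt0.
Qed.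

Lemma gram_invP M (n k : 'I_M) : \sum_j gram_inv n j * g j k = (k == n)%:R.
Proof.
have wn0 m : (w m)^* != 0 by rewrite conjc_eq0 w_neq0.
transitivity ((w k)^* / (w n)^* * (k == n)%:R); last first.
  have [->|_] := eqVneq k n; first by rewrite (divff (wn0 n)) mul1r.
  by rewrite (_ : false%:R = 0) // mulr0.
rewrite -(@cauchy_invP _ M (fun i : 'I_M => (x i)^*) (fun i => x i)) //.
- rewrite mulr_sumr; apply: eq_bigr => j _; rewrite /gram_inv /g.
  set D := cauchy_inv _ _ _ _; have := kern_neq0 j k; have := w_neq0 j.
  have := wn0 n; rewrite [x j * _]mulrC => h1 h2 h3.
  by field; rewrite h1 h2 h3.
- by move=> j m /(inv_inj (@conjcK R)) /x_inj /val_inj.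
- by move=> j m /x_inj /val_inj.
- by move=> j m; rewrite mulrC kern_neq0.
Qed.

(** Up to bounded factors and the reciprocals of two Blaschke products, each
    entry of the inverse of the Gram matrix has the modulus of an entry of the
    Gram matrix of the normalized kernels, so it decays in the same way. *)
Lemma gram_inv_decay M (n j : 'I_M) :
  normc (gram_inv n j) <=
  4 / c1 ^+ 2 * expR ((2 / (1 - p)) ^+ 2) ^+ 2 * p ^+ dist n j.
Proof.
set E := expR _.
pose Pi (m : 'I_M) := \prod_(i < M | i != m) ratio m i.
have Pi_ge0 m : 0 <= Pi m by apply: prodr_ge0 => i _; rewrite divr_ge0 ?normc_ge0.
have xx0 (m i : 'I_M) : i != m -> normc (x m - x i) != 0.
  move=> im; rewrite normc_eq0 subr_eq0; apply: contraNneq im => /x_inj /val_inj ->.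
  exact: eqxx.
have PiE m : \prod_(i < M | i != m) normc (1 - x m * (x i)^*) =
    Pi m * \prod_(i < M | i != m) normc (x m - x i).
  by rewrite -big_split; apply: eq_bigr => i im /=; rewrite divfK ?xx0.
have prod0 m : \prod_(i < M | i != m) normc (x m - x i) != 0.
  by rewrite prodf_seq_neq0; apply/allP => i _; apply/implyP => /xx0.
have kc m i : normc (1 - (x m)^* * x i) = normc (1 - x m * (x i)^*).
  by rewrite mulrC kern_sym.
have kern_nz m i : normc (1 - x m * (x i)^*) != 0 by rewrite gt_eqF ?kern_gt0.
have E1 : normc (\prod_(i < M) (1 - (x n)^* * x i) /
     \prod_(i < M | i != n) ((x n)^* - (x i)^*)) =
    normc (1 - x n * (x n)^*) * Pi n.
  rewrite normcM normcV !normc_prod (bigD1 n) //=.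
  rewrite (eq_bigr _ (fun (i : 'I_M) _ => kc n i)) PiE kc.
  rewrite (_ : \prod_(i < M | i != n) normc ((x n)^* - (x i)^*) =
               \prod_(i < M | i != n) normc (x n - x i)).
    by rewrite mulrA mulfK.
  by apply: eq_bigr => i _; rewrite -rmorphB normc_conj.
have E2 : normc (\prod_(i < M | i != n) (1 - (x i)^* * x j) /
     \prod_(i < M | i != j) (x j - x i)) =
    Pi j * (normc (1 - x j * (x j)^*) / normc (1 - x j * (x n)^*)).
  rewrite normcM normcV !normc_prod.
  rewrite (eq_bigr (fun i : 'I_M => normc (1 - x j * (x i)^*))); last first.
    by move=> i _; rewrite mulrC.
  (* both sides are the product over all [i < M] *)
  have e : \prod_(i < M | i != n) normc (1 - x j * (x i)^*)
      * normc (1 - x j * (x n)^*) =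
     normc (1 - x j * (x j)^*) * (Pi j * \prod_(i < M | i != j) normc (x j - x i)).
    by rewrite -PiE mulrC -!(bigD1 _ (P := predT)
        (F := fun i : 'I_M => normc (1 - x j * (x i)^*))).
  move/(canRL (mulfK (kern_nz j n))): e => ->.
  by field; rewrite kern_nz prod0.
rewrite /gram_inv /cauchy_inv normcM normcV [normc (_ * (w n)^*)]normcM normc_conj.
rewrite normcM E1 E2.
have /andP[wj _] := normw j; have /andP[wn _] := normw n.
have en := eta_gt0 n; have ej := eta_gt0 j.
have ce m : 0 < c1 * eta m by rewrite mulr_gt0.
set k := normc (1 - x j * (x n)^*).
have k0 : 0 < k := kern_gt0 j n.
have E0 : 0 <= E by rewrite expR_ge0.
apply: (le_trans (y := (2 * eta n ^+ 2 * E) * (E * (2 * eta j ^+ 2 / k)) /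
    ((c1 * eta j) * (c1 * eta n)))).
  apply: ler_pM.
  - by rewrite !mulr_ge0 ?normc_ge0 ?Pi_ge0 ?invr_ge0 ?(ltW k0).
  - by rewrite invr_ge0 mulr_ge0 ?normc_ge0.
  - have Epi m : Pi m <= E := prod_ratio_le m.
    apply: ler_pM; rewrite ?mulr_ge0 ?normc_ge0 ?Pi_ge0 ?invr_ge0 ?(ltW k0) //.
      by apply: ler_pM; rewrite ?normc_ge0 ?Pi_ge0 ?kern_diag_le.
    apply: ler_pM; rewrite ?Pi_ge0 ?divr_ge0 ?normc_ge0 ?(ltW k0) //.
    by rewrite ler_wpM2r ?kern_diag_le // invr_ge0 ltW.
  - rewrite lef_pV2 ?posrE ?mulr_gt0 //; last 2 first.
      by rewrite (lt_le_trans (ce j)).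
    by rewrite (lt_le_trans (ce n)).
  by apply: ler_pM; rewrite ?(ltW (ce _)).
have -> : 2 * eta n ^+ 2 * E * (E * (2 * eta j ^+ 2 / k)) /
    (c1 * eta j * (c1 * eta n)) =
    4 / c1 ^+ 2 * E ^+ 2 * (eta n * eta j / normc (1 - x n * (x j)^*)).
  by rewrite kern_sym -/k; field; rewrite !gt_eqF.
apply: ler_wpM2l; last exact: kern_decay.
by rewrite mulr_ge0 ?sqr_ge0 // divr_ge0 ?sqr_ge0.
Qed.

(** Expand the squares and sum the geometric progressions in [n]. *)
Lemma sampling_sumE M (a : 'I_M -> R[i]) P :
  (\sum_(n < P) normc (\sum_k a k * w k * x k ^+ n) ^+ 2)%:C =
  \sum_j \sum_k a j * (a k)^* * (g j k * (1 - (x j * (x k)^*) ^+ P)).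
Proof.
rewrite rmorph_sum /=.
transitivity (\sum_(n < P) \sum_j \sum_k
   a j * (a k)^* * (w j * (w k)^* * (x j * (x k)^*) ^+ n)).
  apply: eq_bigr => n _; rewrite sqr_normcE rmorph_sum /= mulr_suml.
  apply: eq_bigr => j _; rewrite mulr_sumr; apply: eq_bigr => k _.
  by rewrite !rmorphM rmorphXn /= exprMn; ring.
rewrite exchange_big /=; apply: eq_bigr => j _.
rewrite exchange_big /=; apply: eq_bigr => k _.
rewrite -mulr_sumr -mulr_sumr -[1 - _ ^+ P]opprB subrX1; congr (_ * _).
rewrite -mulNr opprB /g mulrA divfK ?kern_neq0 //.
Qed.

Lemma sampling_upper_bound M (a : 'I_M -> R[i]) P :
  \sum_(n < P) normc (\sum_k a k * w k * x k ^+ n) ^+ 2 <=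
  2 * c2 ^+ 2 * (2 / (1 - p)) * \sum_j normc (a j) ^+ 2.
Proof.
set F := \sum_(n < P) _.
have F0 : 0 <= F by apply: sumr_ge0 => n _; exact: sqr_ge0.
rewrite -[F]ger0_norm // -normc_real sampling_sumE.
apply: schur_test => //; first by rewrite mulr_ge0 ?sqr_ge0.
move=> j k; rewrite normcM mulrC -mulrA; apply: ler_pM;
  rewrite ?normc_ge0 ?gram_decay //.
apply: (le_trans (le_normcD _ _)); rewrite normc1 normcN normcX.
suff : normc (x j * (x k)^*) ^+ P <= 1 by lra.
by rewrite exprn_ile1 ?normc_ge0 // (le_trans (normx_le _ _)) // ltW // normx_lt1.
Qed.

(** The error terms contain the [P]-th power of [x j * conj (x k)], and every
    node with index below [M] has modulus at most that of [x M]. *)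
Lemma sampling_sum_lim M (a : 'I_M -> R[i]) : exists K r : R,
  0 <= r < 1 /\ forall P,
  `|\sum_(n < P) normc (\sum_k a k * w k * x k ^+ n) ^+ 2 -
    complex.Re (\sum_j \sum_k a j * (a k)^* * g j k)| <= K * r ^+ P.
Proof.
exists (\sum_j \sum_k normc (a j * (a k)^* * g j k)), (normc (x M)).
split=> [|P]; first by rewrite normc_ge0 normx_lt1.
set F := \sum_(n < P) _.
have -> : F = complex.Re F%:C by [].
rewrite -Re_opp -Re_add sampling_sumE -sumrB.
apply: (le_trans (Re_le_normc _)); apply: (le_trans (normc_sum _ _ _)).
rewrite mulr_suml; apply: ler_sum => j _.
rewrite -sumrB mulr_suml; apply: (le_trans (normc_sum _ _ _)); apply: ler_sum => k _.
have -> : a j * (a k)^* * (g j k * (1 - (x j * (x k)^*) ^+ P)) -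
  a j * (a k)^* * g j k = - (a j * (a k)^* * g j k * (x j * (x k)^*) ^+ P) by ring.
rewrite normcN normcM normcX; apply: ler_wpM2l; rewrite ?normc_ge0 //.
rewrite lerXn2r ?nnegrE ?normc_ge0 // (le_trans (normx_le _ _)) //.
rewrite !normx lerD2l lerN2 ler_sqr ?nnegrE ?(ltW (eta_gt0 _)) //.
by rewrite eta_decr // ltnW.
Qed.

(** As [P] grows, the sums tend to the form of the Gram matrix, which is thus
    positive; its inverse is bounded by [gram_inv_decay] and [schur_test]. *)
Lemma sampling_lower_bound M (a : 'I_M -> R[i]) y :
  (forall P, \sum_(n < P) normc (\sum_k a k * w k * x k ^+ n) ^+ 2 <= y) ->
  (4 / c1 ^+ 2 * expR ((2 / (1 - p)) ^+ 2) ^+ 2 * (2 / (1 - p)))^-1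
    * \sum_j normc (a j) ^+ 2 <= y.
Proof.
move=> Fy; set K := 4 / c1 ^+ 2 * _ * _.
have K'0 : 0 < 4 / c1 ^+ 2 * expR ((2 / (1 - p)) ^+ 2) ^+ 2.
  by rewrite mulr_gt0 ?exprn_gt0 ?expR_gt0 // divr_gt0 ?exprn_gt0.
have K0 : 0 < K by rewrite mulr_gt0 // divr_gt0.
have low := @form_lower_bound R M (fun j k => g j k) (@gram_inv M) K K0.
apply: (le_trans (low _ _ _ _ a)) => [j k|n k|b|b|].
- rewrite /g !rmorphM fmorphV rmorphB rmorphM rmorph1 /= !conjcK.
  by rewrite [_^* * w j]mulrC [_^* * x j]mulrC.
- by rewrite gram_invP eq_sym.
- have [K1 [r [r01 Fr]]] := sampling_sum_lim b.
  apply: (@le_geometric_error R _ _ K1 r r01) => P.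
  have := Fr P; rewrite ler_norml => /andP[_].
  set F := \sum_(n < P) _.
  have F0 : 0 <= F by apply: sumr_ge0 => n _; exact: sqr_ge0.
  rewrite lerBlDr addrC; exact: le_trans.
- by apply: schur_test => //; [exact: ltW|exact: gram_inv_decay].
have [K1 [r [r01 Fr]]] := sampling_sum_lim a.
apply: (@le_geometric_error R _ _ K1 r r01) => P.
have := Fr P; rewrite ler_distlC => /andP[_ h].
by rewrite (le_trans h) // lerD2r.
Qed.
End Sampling.

(** * Carleson radii *)

Section Radii.
Variable R : realType.

(** Every factor of the Carleson products lies in [[0, 1]], so each factor
    dominates the limit of the partial products, hence the infimum. *)
Lemma carleson_separated (r : nat -> R) :
  (forall k, 0 <= r k < 1) -> carleson (fun k => (r k)%:C) ->
  exists2 d, 0 < d & forall k n, k != n -> d * `|1 - r k * r n| <= `|r k - r n|.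
Proof.
move=> r01; rewrite /carleson.
pose b k n := `|r k - r n| / `|1 - r k * r n|.
have bE k n :
    normc ((r k)%:C - (r n)%:C) / normc (1 - ((r k)%:C)^* * (r n)%:C) = b k n.
  have -> : Num.conj (r k)%:C = (r k)%:C by exact: conjc_real.
  by rewrite -(rmorph1 (real_complex R)) -rmorphB -rmorphM -rmorphB !normc_real.
have rr1 k n : r k * r n < 1.
  have /andP[k0 k1] := r01 k; have /andP[n0 n1] := r01 n.
  by rewrite (le_lt_trans _ k1) // ler_piMr // ltW.
have den k n : 0 < `|1 - r k * r n| by rewrite normr_gt0 gt_eqF // subr_gt0.
have b0 k n : 0 <= b k n by rewrite divr_ge0.
have b1 k n : b k n <= 1.
  have e : `|1 - r k * r n| = 1 - r k * r n by rewrite ger0_norm // subr_ge0 ltW.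
  rewrite ler_pdivrMr // mul1r e ler_norml.
  have /andP[k0 k1] := r01 k; have /andP[n0 n1] := r01 n.
  have h1 : 0 <= (1 - r k) * (1 + r n) by rewrite mulr_ge0 //; lra.
  have h2 : 0 <= (1 - r n) * (1 + r k) by rewrite mulr_ge0 //; lra.
  by apply/andP; split; lra.
pose F n M := \prod_(0 <= k < M | k != n) b k n.
pose d := inf (range (fun n => limn (F n))).
rewrite [X in 0 < inf X](_ : _ = range (fun n => limn (F n))); last first.
  apply: (congr1 (fun f : nat -> R => range f)); apply/funext => n; congr (limn _).
  by apply/funext => M; apply: eq_bigr => k _; exact: bE.
move=> d0.
have F0 n M : 0 <= F n M by apply: prodr_ge0.
have Fdec n : nonincreasing_seq (F n).
  apply/nonincreasing_seqP => M; rewrite /F big_mkcond big_nat_recr //= -big_mkcond /=.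
  by case: ifP => _; rewrite ?mulr1 // ler_piMr // -/(F n M).
have Fcvg n : cvgn (F n).
  by apply: nonincreasing_is_cvgn => //; exists 0 => _ [M _ <-].
have L0 n : 0 <= limn (F n) by apply: limr_ge => //; apply: nearW.
exists d => // k n kn.
rewrite -ler_pdivlMr // -/(b k n).
apply: (le_trans (y := limn (F n))).
  apply: ge_inf; last by exists n.
  by exists 0 => _ [m _ <-].
apply: (le_trans (y := F n k.+1)); first exact: nonincreasing_cvgn_ge.
rewrite /F big_mkcond big_nat_recr //= kn -big_mkcond /= ler_piMl //.
elim: k {kn} => [|k IH]; first by rewrite big_geq.
rewrite big_mkcond big_nat_recr //= -big_mkcond /=.
case: ifP => _; last by rewrite mulr1.
by rewrite -[leRHS]mulr1 ler_pM // prodr_ge0.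
Qed.

Lemma one_subX_le (r : R) N : 0 <= r <= 1 -> 1 - r ^+ N <= N%:R * (1 - r).
Proof.
move=> /andP[r0 r1]; rewrite -[1 - _ ^+ N]opprB subrX1 -mulNr opprB mulrC.
rewrite ler_wpM2r ?subr_ge0 //.
rewrite -[N in N%:R]card_ord -sumr_const; apply: ler_sum => i _.
by rewrite exprn_ile1.
Qed.

(** Separation of consecutive radii makes the distances to [1] decrease
    geometrically. This property, unlike the Carleson condition itself, passes
    easily to powers: [r k.+1 ^+ N - r k ^+ N] is at least
    [r 1 ^+ N.-1 * (r k.+1 - r k)], and [1 - r k ^+ N] is at most
    [N * (1 - r k)]. The radius [r 1] is positive even if [r 0] vanishes. *)
Lemma pow_radii_geometric (r : nat -> R) (d : R) (N : nat) :
  (forall k, 0 <= r k < 1) -> (forall j k, (j < k)%N -> r j < r k) ->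
  0 < d -> (forall k n, k != n -> d * `|1 - r k * r n| <= `|r k - r n|) ->
  (0 < N)%N ->
  exists2 Q, 0 < Q < 1 & forall k, 1 - r k.+1 ^+ N <= Q * (1 - r k ^+ N).
Proof.
move=> r01 rinc d0 hd N0.
have r0 k : 0 <= r k by case/andP: (r01 k).
have r1 k : r k < 1 by case/andP: (r01 k).
pose d' := d * r 1%N ^+ N.-1 / N%:R.
have NR : 0 < N%:R :> R by rewrite ltr0n.
have d'0 : 0 < d'.
  by rewrite divr_gt0 // mulr_gt0 // exprn_gt0 // (le_lt_trans (r0 0%N)) ?rinc.
have rN1 k : 1 - r k ^+ N <= N%:R * (1 - r k).
  by rewrite one_subX_le // r0 ltW.
have step k : 1 - r k.+1 ^+ N <= (1 - d') * (1 - r k ^+ N).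
  suff : d' * (1 - r k ^+ N) <= r k.+1 ^+ N - r k ^+ N by lra.
  have rk := rinc k k.+1 (ltnSn k).
  apply: (le_trans (y := r 1%N ^+ N.-1 * (r k.+1 - r k))); last first.
    rewrite subrXX mulrC ler_wpM2l ?subr_ge0 ?(ltW rk) //.
    rewrite -(prednK N0) big_ord_recl /= subn0 mulr1 -[leLHS]addr0.
    apply: lerD; last by apply: sumr_ge0 => i _; rewrite mulr_ge0 ?exprn_ge0.
    rewrite lerXn2r ?nnegrE //.
    by case: k {rk} => // k; rewrite ltW // rinc.
  have hk : d * (1 - r k) <= r k.+1 - r k.
    have := hd k k.+1; rewrite ltn_eqF // => /(_ isT).
    rewrite [`|r k - _|]distrC [`|r k.+1 - _|]ger0_norm ?subr_ge0 ?(ltW rk) //.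
    apply: le_trans; rewrite ler_wpM2l ?(ltW d0) //.
    rewrite (le_trans _ (ler_norm _)) // lerD2l lerN2.
    by rewrite ler_piMr // ltW.
  apply: (le_trans (y := r 1%N ^+ N.-1 * (d * (1 - r k)))); last first.
    by rewrite ler_wpM2l ?exprn_ge0.
  apply: (le_trans (y := d' * (N%:R * (1 - r k)))); first by rewrite ler_wpM2l ?(ltW d'0).
  by rewrite /d' le_eqVlt; apply/orP; left; apply/eqP; field; rewrite gt_eqF.
exists (1 - d') => //; apply/andP; split; last by rewrite ltrBlDr ltrDl.
have := step 0%N; have : 0 < 1 - r 1%N ^+ N by rewrite subr_gt0 exprn_ilt1 ?r0 // -?lt0n.
have : 0 < 1 - r 0%N ^+ N by rewrite subr_gt0 exprn_ilt1 ?r0 // -?lt0n.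
move=> h0 h1 h2; rewrite -(pmulr_lgt0 _ h0); exact: lt_le_trans h2.
Qed.

Lemma weight_upper (r : R) N : 0 <= r < 1 -> (0 < N)%N ->
  Num.sqrt (1 - r ^+ 2) <= 2 * Num.sqrt (1 - r ^+ N).
Proof.
move=> /andP[r0 r1] N0.
have h1 : r ^+ N <= r by rewrite -(prednK N0) exprS ler_piMr ?exprn_ile1 // ltW.
have -> : 2 * Num.sqrt (1 - r ^+ N) = Num.sqrt (4 * (1 - r ^+ N)).
  have -> : (4 : R) = 2 ^+ 2 by ring.
  by rewrite sqrtrM ?sqr_ge0 // sqrtr_sqr ger0_norm.
apply: ler_wsqrtr.
have : 0 <= (1 - r) ^+ 2 by exact: sqr_ge0.
rewrite !expr2; lra.
Qed.

Lemma weight_lower (r : R) N : 0 <= r < 1 -> (0 < N)%N ->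
  Num.sqrt (1 - r ^+ N) <= N%:R * Num.sqrt (1 - r ^+ 2).
Proof.
move=> /andP[r0 r1] N0.
have -> : N%:R * Num.sqrt (1 - r ^+ 2) = Num.sqrt (N%:R ^+ 2 * (1 - r ^+ 2)).
  by rewrite sqrtrM ?sqr_ge0 // sqrtr_sqr ger0_norm.
apply: ler_wsqrtr.
have h : 1 - r ^+ N <= N%:R * (1 - r) by rewrite one_subX_le // r0 ltW.
apply: (le_trans h); rewrite expr2 -mulrA ler_wpM2l //.
have N1 : 1 <= N%:R :> R by rewrite ler1n.
have r2 : 1 - r <= 1 - r ^+ 2 by rewrite lerD2l lerN2 expr2 ler_piMr // ltW.
apply: (le_trans r2); rewrite ler_peMl //; lra.
Qed.
End Radii.

(** * Frames and orbits in a Hilbert space *)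

Section Hilbert.
Variables (R : realType) (H : completeNormedModType R[i]).
Variable (ip : {dot H for Num.conj}).
Hypothesis ip_norm : induces_norm ip.
Implicit Types (x y z f g l : H).

Lemma hnormE (x : H) : `|x| = (hnorm x)%:C.
Proof. by rewrite /hnorm RRe_real // normr_real. Qed.

Lemma hnorm_ge0 (x : H) : 0 <= hnorm x.
Proof. by rewrite -lecR -hnormE normr_ge0. Qed.

Lemma hnorm_sqr (x : H) : (hnorm x ^+ 2)%:C = ip x x.
Proof. by rewrite rmorphXn /= -hnormE; exact: ip_norm. Qed.

Lemma ipDl x y z : ip (x + y) z = ip x z + ip y z. Proof. exact: linearDl. Qed.
Lemma ipBl x y z : ip (x - y) z = ip x z - ip y z. Proof. exact: linearBl. Qed.
Lemma ipZl a y z : ip (a *: y) z = a * ip y z. Proof. exact: linearZl_LR. Qed.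
Lemma ipZr a y z : ip y (a *: z) = Num.conj a * ip y z. Proof. exact: linearZr_LR. Qed.
Lemma ipBr x y z : ip z (x - y) = ip z x - ip z y. Proof. exact: linearBr. Qed.
Lemma ipC x y : ip x y = Num.conj (ip y x). Proof. by rewrite hermC mul1r. Qed.

(** Expand the squared norm of [x] minus its projection on [y]. *)
Lemma ip_cauchy_schwarz x y : normc (ip x y) <= hnorm x * hnorm y.
Proof.
have [->|y0] := eqVneq y 0.
  by rewrite linear0r normc0 mulr_ge0 ?hnorm_ge0.
have ny0 : hnorm y != 0.
  apply: contraNneq y0 => y0; by rewrite -normr_eq0 hnormE y0.
have ny : 0 < hnorm y by rewrite lt_neqAle eq_sym ny0 hnorm_ge0.
pose a := ip x y / (hnorm y ^+ 2)%:C.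
have c0 : (hnorm y ^+ 2)%:C != 0 :> R[i].
  by rewrite -(rmorph0 (real_complex R)) (inj_eq (@complexI R)) expf_neq0.
have aC : Num.conj a = Num.conj (ip x y) / (hnorm y ^+ 2)%:C.
  rewrite /a rmorphM; congr (_ * _); apply: etrans (conjc_inv _) _.
  by congr (_^-1); exact: conjc_real.
have E : (hnorm (x - a *: y) ^+ 2)%:C =
   (hnorm x ^+ 2 - normc (ip x y) ^+ 2 / hnorm y ^+ 2)%:C.
  rewrite hnorm_sqr ipBl !ipBr !ipZl !ipZr -!hnorm_sqr (ipC y x) aC.
  rewrite [RHS]rmorphB [X in _ = _ - X]rmorphM [X in _ = _ - _ * X]fmorphV.
  rewrite -[X in _ = _ - X / _]/((normc (ip x y) ^+ 2)%:C) sqr_normcE /a.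
  rewrite -[X in _ = X - _]/((hnorm x ^+ 2)%:C).
  rewrite -[X in _ = _ - _ / X]/((hnorm y ^+ 2)%:C).
  set c := (hnorm y ^+ 2)%:C in c0 *; set z := ip x y.
  by clearbody c; field.
have := sqr_ge0 (hnorm (x - a *: y)); rewrite (complexI E).
rewrite subr_ge0 ler_pdivrMr ?exprn_gt0 // -exprMn ler_sqr ?nnegrE //.
  by rewrite normc_ge0.
by rewrite mulr_ge0 ?hnorm_ge0.
Qed.

Lemma hnormD x y : hnorm (x + y) <= hnorm x + hnorm y.
Proof. by have := ler_normD x y; rewrite !hnormE -rmorphD lecR. Qed.

Lemma hnormB x y : hnorm (x - y) = hnorm (y - x).
Proof. by rewrite /hnorm distrC. Qed.

Lemma hnorm_sub_le x y : hnorm x - hnorm y <= hnorm (x - y).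
Proof. by rewrite lerBlDr -{1}(subrK y x) hnormD. Qed.

Lemma cvg_of_dist (T : Type) (F : set_system T) (FF : Filter F)
    (a d : T -> R) (l : R) :
  (forall t, `|l - a t| <= d t) -> d @ F --> 0 -> a @ F --> l.
Proof.
move=> ad /cvgrPdist_lt d0; apply/cvgrPdist_lt => e e0.
apply: filterS (d0 e e0) => t; rewrite sub0r normrN; apply: le_lt_trans.
by rewrite (le_trans (ad t)) // ler_norm.
Qed.

Lemma cvg_hnorm_sub (u : nat -> H) l : u @ \oo --> l ->
  (fun n => hnorm (l - u n)) @ \oo --> (0 : R).
Proof.
move=> /cvgrPdist_lt ul; apply/cvgrPdist_lt => e e0.
have e0' : (0 : R[i]) < e%:C by rewrite ltcR.
apply: filterS (ul _ e0') => n /=.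
by rewrite sub0r normrN ger0_norm ?hnorm_ge0 // hnormE ltcR.
Qed.

Lemma cvg_hnorm (u : nat -> H) l : u @ \oo --> l ->
  (fun n => hnorm (u n)) @ \oo --> hnorm l.
Proof.
move=> /cvg_hnorm_sub; apply: cvg_of_dist => n.
by rewrite ler_norml hnorm_sub_le andbT lerNl opprB hnormB hnorm_sub_le.
Qed.

Lemma cvg_ip_normc (u : nat -> H) l g : u @ \oo --> l ->
  (fun n => normc (ip (u n) g)) @ \oo --> normc (ip l g).
Proof.
move=> /cvg_hnorm_sub h.
have h2 : (fun n => hnorm (l - u n) * hnorm g) @ \oo --> (0 : R).
  by rewrite -(mul0r (hnorm g)); apply: cvgM => //; exact: cvg_cst.
apply: cvg_of_dist h2 => n; apply: le_trans (ip_cauchy_schwarz _ _).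
rewrite ipBl ler_norml subr_normc_le andbT lerNl opprB.
by rewrite normcB subr_normc_le.
Qed.

Lemma ip_lim_const (u : nat -> H) l g c : u @ \oo --> l ->
  (\forall n \near \oo, ip (u n) g = c) -> ip l g = c.
Proof.
move=> ul uc; apply/eqP; rewrite -subr_eq0 -normc_eq0 eq_le normc_ge0 andbT.
have h2 : (fun n => hnorm (l - u n) * hnorm g) @ \oo --> (0 : R).
  rewrite -(mul0r (hnorm g)); apply: cvgM; last exact: cvg_cst.
  exact: cvg_hnorm_sub.
apply: (ler_cvg_to (cvg_cst (normc (ip l g - c))) h2).
apply: filterS uc => n <-; rewrite -ipBl; exact: ip_cauchy_schwarz.
Qed.

Variable (e : nat -> H).
Hypothesis e_basis : orthonormal_basis ip e.

Lemma ip_e j k : ip (e j) (e k) = (j == k)%:R.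
Proof. by case: e_basis. Qed.

Lemma hnorm_e k : hnorm (e k) = 1.
Proof.
apply/eqP; rewrite -(@eqrXn2 _ 2) ?hnorm_ge0 // expr1n; apply/eqP.
by apply: complexI; rewrite hnorm_sqr ip_e eqxx.
Qed.

Definition basis_partial (f : H) M := \sum_(k < M) ip f (e k) *: e k.

Lemma basis_partial_cvg f : basis_partial f @ \oo --> f.
Proof.
case: e_basis => _ /(_ f); rewrite /series.
by under eq_fun => n do rewrite big_mkord.
Qed.

Lemma ip_sum_coord (c : nat -> R[i]) M g :
  ip (\sum_(k < M) c k *: e k) g = \sum_(k < M) c k * ip (e k) g.
Proof.
elim: M => [|M IH]; first by rewrite !big_ord0 linear0l.
by rewrite !big_ord_recr /= ipDl IH ipZl.
Qed.

Lemma ip_sum_basis (c : nat -> R[i]) M j :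
  ip (\sum_(k < M) c k *: e k) (e j) = if (j < M)%N then c j else 0.
Proof.
rewrite ip_sum_coord; under eq_bigr => k _ do rewrite ip_e.
case: ltnP => jM.
  rewrite (bigD1 (Ordinal jM)) //= eqxx mulr1 big1 ?addr0 // => k kj.
  by rewrite (_ : (k == j :> nat) = false) ?mulr0 //; apply: negPf.
rewrite big1 // => k _; rewrite (_ : (k == j :> nat) = false) ?mulr0 //.
by rewrite ltn_eqF // (leq_trans _ jM).
Qed.

Lemma basis_partial_norm f M :
  hnorm (basis_partial f M) ^+ 2 = \sum_(k < M) normc (ip f (e k)) ^+ 2.
Proof.
apply: complexI; rewrite hnorm_sqr sum_sqr_normcE.
rewrite {1}/basis_partial (ip_sum_coord (fun k => ip f (e k))).
apply: eq_bigr => j _; rewrite (ipC (e j)) /basis_partial.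
by rewrite (ip_sum_basis (fun k => ip f (e k))) ltn_ord.
Qed.

(** Both frame bounds pass from the partial expansions of [f] to [f]. The upper
    one does so term by term; for the lower one, the upper bound applied to
    [f - basis_partial f M] controls the error made in the frame sums. The
    inequality [normc (z + u) ^+ 2 <= 2 * normc z ^+ 2 + 2 * normc u ^+ 2] is
    used there, which costs a factor 2 in the lower bound. The second hypothesis
    is phrased with an upper bound [y] of all partial sums so that it does not
    presuppose convergence. *)
Lemma frame_of_finite (g : nat -> H) (A B : R) : 0 < A -> 0 < B ->
  (forall f M P, \sum_(n < P) normc (ip (basis_partial f M) (g n)) ^+ 2
     <= B * hnorm (basis_partial f M) ^+ 2) ->
  (forall f M (y : R),
     (forall P, \sum_(n < P) normc (ip (basis_partial f M) (g n)) ^+ 2 <= y) ->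
     A * hnorm (basis_partial f M) ^+ 2 <= y) ->
  frame ip [set: nat] g.
Proof.
move=> A0 B0 up lo.
have cvg_sq f : (fun M => hnorm (basis_partial f M) ^+ 2) @ \oo --> hnorm f ^+ 2.
  by apply: cvgM; apply: cvg_hnorm; exact: basis_partial_cvg.
have upf f P : \sum_(n < P) normc (ip f (g n)) ^+ 2 <= B * hnorm f ^+ 2.
  have c1 :
    (fun M => \sum_(n < P) normc (ip (basis_partial f M) (g n)) ^+ 2) @ \oo -->
     \sum_(n < P) normc (ip f (g n)) ^+ 2.
    apply: cvg_big => [|n _]; first exact: add_continuous.
    by apply: cvgM; apply: cvg_ip_normc; exact: basis_partial_cvg.
  have c2 : (fun M => B * hnorm (basis_partial f M) ^+ 2) @ \oo -->
      B * hnorm f ^+ 2.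
    by apply: cvgM => //; exact: cvg_cst.
  by apply: (ler_cvg_to c1 c2); apply: nearW => M.
have lof f (y : R) : (forall P, \sum_(n < P) normc (ip f (g n)) ^+ 2 <= y) ->
    A / 2 * hnorm f ^+ 2 <= y.
  move=> fy.
  have h M : A * hnorm (basis_partial f M) ^+ 2 <=
      2 * y + 2 * B * hnorm (f - basis_partial f M) ^+ 2.
    apply: lo => P.
    apply: (le_trans (y := 2 * \sum_(n < P) normc (ip f (g n)) ^+ 2 +
        2 * \sum_(n < P) normc (ip (f - basis_partial f M) (g n)) ^+ 2)).
      rewrite !mulr_sumr -big_split; apply: ler_sum => n _.
      have -> : ip (basis_partial f M) (g n) =
          ip f (g n) + - ip (f - basis_partial f M) (g n).
        by rewrite ipBl opprB addrCA subrr addr0.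
      by apply: (le_trans (sqr_normcD_le _ _)); rewrite normcN.
    by apply: lerD; rewrite -?mulrA ler_wpM2l.
  have c1 : (fun M => A * hnorm (basis_partial f M) ^+ 2) @ \oo -->
      A * hnorm f ^+ 2.
    by apply: cvgM => //; exact: cvg_cst.
  have c2 : (fun M => 2 * y + 2 * B * hnorm (f - basis_partial f M) ^+ 2)
      @ \oo --> 2 * y.
    rewrite -[X in _ --> X]addr0; apply: cvgD; first exact: cvg_cst.
    rewrite -(mulr0 (2 * B)); apply: cvgM; first exact: cvg_cst.
    rewrite -(mulr0 (0 : R)); apply: cvgM; apply: cvg_hnorm_sub; exact: basis_partial_cvg.
  have : A * hnorm f ^+ 2 <= 2 * y.
    by apply: (ler_cvg_to c1 c2); apply: nearW => M.
  by rewrite mulrAC ler_pdivrMr // mulrC [y * 2]mulrC mulrC.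
exists (A / 2), B; split => // [|f]; first by rewrite divr_gt0.
rewrite -nneseries_esumT => [|n]; last by rewrite lee_fin sqr_ge0.
have u0 n : (0 <= (normc (ip f (g n)) ^+ 2)%:E)%E by rewrite lee_fin sqr_ge0.
have psum P : (\sum_(0 <= n < P) (normc (ip f (g n)) ^+ 2)%:E)%E =
    (\sum_(n < P) normc (ip f (g n)) ^+ 2)%:E by rewrite sumEFin big_mkord.
split; last first.
  apply: lime_le; first exact: is_cvg_nneseries.
  by apply: nearW => P; rewrite psum lee_fin.
case E : (\sum_(0 <= n <oo) (normc (ip f (g n)) ^+ 2)%:E)%E => [y| |].
- rewrite lee_fin; apply: lof => P; rewrite -lee_fin -psum -E.
  exact: nneseries_lim_ge.
- by rewrite leey.
- have : (0 <= \sum_(0 <= n <oo) (normc (ip f (g n)) ^+ 2)%:E)%E.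
    exact: nneseries_ge0.
  by rewrite E.
Qed.

Variables (T : {linear H -> H}) (lambda : nat -> R[i]).
Hypothesis T_bounded : bounded_near T (nbhs (0 : H)).
Hypothesis T_e : forall k, T (e k) = lambda k *: e k.

Lemma iter_cvg (u : nat -> H) l n : u @ \oo --> l ->
  (fun M => iter n T (u M)) @ \oo --> iter n T l.
Proof.
move=> ul; elim: n => //= n IH.
have Tc : continuous T by apply/linear_bounded_continuous.
exact: (continuous_cvg _ (Tc _) IH).
Qed.

Lemma iter_sum (v : nat -> R[i]) n M :
  iter n T (\sum_(k < M) v k *: e k) = \sum_(k < M) (v k * lambda k ^+ n) *: e k.
Proof.
elim: n => [|n IH] /=; first by apply: eq_bigr => k _; rewrite mulr1.
rewrite IH linear_sum; apply: eq_bigr => k _.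
by rewrite linearZ /= T_e scalerA exprSr mulrA.
Qed.

(** The orbit of [phi] has the coordinates that termwise application of [T]
    suggests, because [T] and the inner product are continuous. *)
Lemma iter_coord (v : nat -> R[i]) phi n j :
  (fun M => \sum_(k < M) v k *: e k) @ \oo --> phi ->
  ip (iter n T phi) (e j) = v j * lambda j ^+ n.
Proof.
move=> h; have c := iter_cvg (n := n) h; apply: (ip_lim_const c).
exists j.+1 => // M /= jM.
by rewrite iter_sum (ip_sum_basis (fun k => v k * lambda k ^+ n)) jM.
Qed.

Lemma series_cvg_geometric (v : nat -> R[i]) (K p : R) :
  0 <= p < 1 -> (forall k, normc (v k) <= K * p ^+ k) ->
  cvgn (series (fun k => v k *: e k)).
Proof.
move=> /andP[p0 p1] vK; apply/cauchy_cvgP/cauchy_seriesP => t t0.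
(* a positive element of [R[i]] is real, so a real geometric series suffices *)
have [tr0 tE] : 0 < complex.Re t /\ t = (complex.Re t)%:C.
  have tE : t = (complex.Re t)%:C by rewrite RRe_real // gtr0_real.
  by split => //; rewrite -ltcR -tE.
have : cvgn (series (geometric K p)).
  by apply: is_cvg_geometric_series; rewrite ger0_norm.
move=> /cauchy_cvgP/cauchy_seriesP /(_ _ tr0).
apply: filterS => -[a b] /=; rewrite {2}tE => h.
apply: le_lt_trans (ler_norm_sum _ _ _) _.
apply: (le_lt_trans (y := (\sum_(a <= k < b) K * p ^+ k)%:C)).
  rewrite rmorph_sum /=; apply: ler_sum => k _.
  rewrite normrZ hnormE hnorm_e mulr1.
  have -> : `|v k| = (normc (v k))%:C by [].
  by rewrite lecR.
by rewrite ltcR (le_lt_trans (ler_norm _)).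
Qed.

End Hilbert.

(** * Orbits of a diagonal operator *)

Section OrbitFrame.
Variables (R : realType) (lambda : nat -> R[i]) (H : completeNormedModType R[i]).
Variables (ip : {dot H for Num.conj}) (e : nat -> H) (T : {linear H -> H}).
Variables (m : nat -> R[i]) (C1 C2 : R) (phi : H).
Hypothesis lambda_disc : forall k, normc (lambda k) < 1.
Hypothesis lambda_incr : forall j k : nat,
  (j < k)%N -> normc (lambda j) < normc (lambda k).
Hypothesis lambda_carleson : carleson (fun k => (normc (lambda k))%:C).
Hypothesis H_hilbert : induces_norm ip.
Hypothesis e_basis : orthonormal_basis ip e.
Hypothesis T_bounded : bounded_near T (nbhs (0 : H)).
Hypothesis T_e : forall k, T (e k) = lambda k *: e k.
Hypothesis C1_gt0 : 0 < C1.
Hypothesis m_bounds : forall k, C1 <= normc (m k) <= C2.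

Let v k := m k * (Num.sqrt (1 - normc (lambda k) ^+ 2))%:C.
Hypothesis phi_def : phi = limn (series (fun k => v k *: e k)).

(** The inner product of a finite combination of the basis with the [n]-th
    vector is [\sum_k a k * w k * x k ^+ n] with nodes [x k], the conjugates of
    [lambda k ^+ N], and with weights [w k], the conjugates of
    [v k * lambda k ^+ q]. As [1 - r ^+ 2] and [1 - r ^+ N] are comparable, the
    weights have the size required by the sampling bounds. The assumption on
    [lambda 0] keeps the factors [lambda k ^+ q] away from 0; it holds for
    [q = 0] even if [lambda 0 = 0]. *)
Lemma orbit_frame (N q : nat) : (0 < N)%N -> 0 < normc (lambda 0%N) ^+ q ->
  frame ip [set: nat] (fun n => iter (q + N * n) T phi).
Proof.
move=> N0 lq.
pose r k := normc (lambda k).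
have r01 k : 0 <= r k < 1 by rewrite normc_ge0 lambda_disc.
have rq k : r 0%N ^+ q <= r k ^+ q <= 1.
  apply/andP; split; last first.
    by have /andP[? /ltW ?] := r01 k; rewrite exprn_ile1.
  rewrite lerXn2r ?nnegrE ?normc_ge0 //.
  by case: k => // k; rewrite ltW // lambda_incr.
have [d d0 hd] := carleson_separated r01 lambda_carleson.
have geo L : (0 < L)%N -> exists2 p, 0 < p < 1 &
    forall k, Num.sqrt (1 - r k.+1 ^+ L) <= p * Num.sqrt (1 - r k ^+ L).
  move=> L0; have [Q /andP[Q0 Q1] hQ] := pow_radii_geometric r01 lambda_incr d0 hd L0.
  exists (Num.sqrt Q); first by rewrite sqrtr_gt0 Q0 /= -[ltRHS]sqrtr1 ltr_sqrt.
  by move=> k; rewrite -sqrtrM ?(ltW Q0) // ler_wsqrtr.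
have sq_gt0 L k : (0 < L)%N -> 0 < 1 - r k ^+ L.
  move=> L0; rewrite subr_gt0 exprn_ilt1 -?lt0n //.
    by case/andP: (r01 k).
  by case/andP: (r01 k).
have nv k : normc (v k) = normc (m k) * Num.sqrt (1 - r k ^+ 2).
  by rewrite normcM normc_real ger0_norm ?sqrtr_ge0.
have vcvg : (fun M => \sum_(k < M) v k *: e k) @ \oo --> phi.
  have [p /andP[p0 p1] hp] := geo 2%N isT.
  have dec k : Num.sqrt (1 - r k ^+ 2) <= p ^+ k.
    elim: k => [|k IH].
      by rewrite expr0 -[leRHS]sqrtr1 ler_wsqrtr // gerBl sqr_ge0.
    by rewrite (le_trans (hp k)) // [p ^+ _]exprS ler_wpM2l // ltW.
  have c : cvgn (series (fun k => v k *: e k)).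
    apply: (series_cvg_geometric H_hilbert e_basis (K := C2) (p := p)).
      by rewrite (ltW p0).
    move=> k; rewrite nv; have /andP[_ h2] := m_bounds k.
    by apply: ler_pM; rewrite ?normc_ge0 ?sqrtr_ge0.
  have -> : (fun M => \sum_(k < M) v k *: e k) = series (fun k => v k *: e k).
    by apply/funext => M; rewrite /series /= big_mkord.
  by rewrite phi_def.
have [p p01 hp] := geo N N0.
pose eta k := Num.sqrt (1 - r k ^+ N).
pose x k : R[i] := Num.conj (lambda k ^+ N).
pose w k : R[i] := Num.conj (v k * lambda k ^+ q).
have eta_gt0 k : 0 < eta k by rewrite sqrtr_gt0 sq_gt0.
have normx k : normc (x k) = 1 - eta k ^+ 2.
  rewrite /x normc_conj normcX /eta sqr_sqrtr ?(ltW (sq_gt0 _ _ N0)) //.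
  by rewrite opprB addrCA subrr addr0.
pose c1 := C1 / N%:R * r 0%N ^+ q.
pose c2 := C2 * 2.
have NR : 0 < N%:R :> R by rewrite ltr0n.
have c1_gt0 : 0 < c1 by rewrite mulr_gt0 // divr_gt0.
have normw k : c1 * eta k <= normc (w k) <= c2 * eta k.
  rewrite /w normc_conj normcM normcX nv -/(r k).
  have /andP[h1 h2] := m_bounds k; have /andP[h3 h4] := rq k.
  have up := weight_upper (r01 k) N0; have lo := weight_lower (r01 k) N0.
  apply/andP; split.
    rewrite /c1 mulrAC; apply: ler_pM => //; rewrite ?(ltW lq) //.
      by rewrite mulr_ge0 ?(ltW (eta_gt0 k)) // divr_ge0 // ltW.
    rewrite -mulrA; apply: ler_pM => //; rewrite ?(ltW C1_gt0) //.
      by rewrite mulr_ge0 ?invr_ge0 ?(ltW NR) ?(ltW (eta_gt0 k)).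
    by rewrite mulrC ler_pdivrMr // mulrC.
  rewrite -[leRHS]mulr1; apply: ler_pM => //; rewrite ?exprn_ge0 ?normc_ge0 //.
    by rewrite mulr_ge0 ?normc_ge0 ?sqrtr_ge0.
  by rewrite /c2 -mulrA; apply: ler_pM; rewrite ?normc_ge0 ?sqrtr_ge0.
have coord f M n : ip (basis_partial ip e f M) (iter (q + N * n) T phi) =
    \sum_(k < M) ip f (e k) * w k * x k ^+ n.
  rewrite (ip_sum_coord ip e (fun k => ip f (e k))); apply: eq_bigr => k _.
  rewrite (ipC ip (e k)) (iter_coord H_hilbert e_basis T_bounded T_e (v := v)) //.
  by rewrite -mulrA -rmorphXn -rmorphM exprD exprM mulrA.
have A0 := sampling_lower_bound p01 eta_gt0 hp normx c1_gt0 normw.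
have B0 := sampling_upper_bound p01 eta_gt0 hp normx normw.
have /andP[p0 p1] := p01; have q0 : 0 < 1 - p by rewrite subr_gt0.
apply: (frame_of_finite H_hilbert e_basis
  (A := (4 / c1 ^+ 2 * expR ((2 / (1 - p)) ^+ 2) ^+ 2 * (2 / (1 - p)))^-1)
  (B := 2 * c2 ^+ 2 * (2 / (1 - p)))).
- rewrite invr_gt0 mulr_gt0 ?divr_gt0 // mulr_gt0 ?exprn_gt0 ?expR_gt0 //.
  by rewrite divr_gt0 // exprn_gt0.
- have C2_gt0 : 0 < C2.
    by have /andP[h1 h2] := m_bounds 0; rewrite (lt_le_trans C1_gt0) // (le_trans h1).
  by rewrite mulr_gt0 ?divr_gt0 // mulr_gt0 // exprn_gt0 // mulr_gt0.
- move=> f M P; rewrite basis_partial_norm //.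
  under eq_bigr => n _ do rewrite coord.
  exact: B0.
- move=> f M y fy; rewrite basis_partial_norm //; apply: A0 => P.
  apply: le_trans (fy P); rewrite le_eqVlt; apply/orP; left; apply/eqP.
  by apply: eq_bigr => n _; rewrite coord.
Qed.
End OrbitFrame.

Lemma frame_shift (R : realType) (H : normedModType R[i])
    (ip : {dot H for Num.conj}) (g : nat -> H) (K : nat) :
  frame ip [set: nat] (fun n => g (K + n)%N) ->
  frame ip [set k : nat | (K <= k)%N] g.
Proof.
move=> [A [B [A0 B0 AB]]]; exists A, B; split => // f.
rewrite (@reindex_esum R _ _ [set: nat] _ (addn K)); first exact: AB.
split => [n _|n k _ _|k /= Kk]; first exact: leq_addr.
  exact: addnI.
by exists (k - K)%N => //; exact: subnKC.
Qed.

(* Sequences indexed by k >= 1 in the mathematics are indexed from 0 here;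
   in particular lambda 0 is lambda_1. *)
Theorem theorem2p1 (R : realType) (lambda : nat -> R[i])
    (H : completeNormedModType R[i]) (ip : {dot H for Num.conj})
    (e : nat -> H) (T : {linear H -> H}) (m : nat -> R[i]) (C1 C2 : R)
    (phi : H)
    (lambda_disc : forall k, normc (lambda k) < 1)
    (lambda_incr : forall j k : nat,
       (j < k)%N -> normc (lambda j) < normc (lambda k))
    (lambda_carleson : carleson (fun k => (normc (lambda k))%:C))
    (H_hilbert : induces_norm ip)
    (H_separable : exists2 D : set H, countable D & dense D)
    (e_basis : orthonormal_basis ip e)
    (T_bounded : bounded_near T (nbhs (0 : H)))
    (T_e : forall k, T (e k) = lambda k *: e k)
    (C1_gt0 : 0 < C1)
    (m_bounds : forall k, C1 <= normc (m k) <= C2)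
    (phi_def : phi = limn (series (fun k =>
       (m k * (Num.sqrt (1 - normc (lambda k) ^+ 2))%:C) *: e k))) :
  [/\ (forall N : nat, (0 < N)%N ->
         frame ip [set: nat] (fun k => iter (N * k) T phi)),
      (lambda 0%N != 0 -> forall N K : nat, (0 < N)%N -> (0 < K)%N ->
         frame ip [set k : nat | (K <= k)%N] (fun k => iter (N * k) T phi))
    & (lambda 0%N != 0 -> forall N j : nat, (0 < N)%N -> (j < N)%N ->
         frame ip [set: nat] (fun k => iter (j + N * k) T phi))].
Proof.
have orbit := orbit_frame lambda_disc lambda_incr lambda_carleson H_hilbert
  e_basis T_bounded T_e C1_gt0 m_bounds phi_def.
have lam0 q : lambda 0%N != 0 -> 0 < normc (lambda 0%N) ^+ q.
  by move=> l0; rewrite exprn_gt0 // lt_neqAle eq_sym normc_eq0 l0 normc_ge0.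
split=> [N N0|l0 N K N0 K0|l0 N j N0 jN].
- exact: (orbit N 0%N N0 ltr01).
- apply: frame_shift.
  under eq_fun => n do rewrite mulnDr.
  by apply: orbit => //; exact: lam0.
- by apply: orbit => //; exact: lam0.
Qed.
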